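(* Let $N$ be a homogeneous norm on $\mathbb{H}^n$ having the midpoint property. Then $N$ has the geodesic linearity property.
   Context: For $n\geq 1$, the Heisenberg group $\mathbb{H}^n$ is the set $\mathbb{R}^{2n}\times\mathbb{R}$ with group law $(z,t)\ast(z',t')=(z+z',\,t+t'+2\omega_n(z,z'))$, where $\omega_n(z,z')=\langle z,J_nz'\rangle$, $J_n=\begin{pmatrix}0&-E_n\\ E_n&0\end{pmatrix}$ and $E_n$ is the $n\times n$ identity matrix. The neutral element is $e=(0,0)$ and $(z,t)^{-1}=(-z,-t)$. For $\lambda>0$ the dilation is $\delta_\lambda(z,t)=(\lambda z,\lambda^2t)$. A homogeneous norm on $\mathbb{H}^n$ is a function $N:\mathbb{H}^n\to[0,\infty)$ with $N(p)=0\Leftrightarrow p=e$, $N(p^{-1})=N(p)$, $N(p\ast q)\leq N(p)+N(q)$ and $N(\delta_\lambda(p))=\lambda N(p)$ for all $p,q\in\mathbb{H}^n$, $\lambda>0$. It induces the left-invariant metric $d_N(p,q)=N(p^{-1}\ast q)$. $N$ has the midpoint property if for all $p_1,p_2,q\in\mathbb{H}^n$: $d_N(p_1,p_2)=2d_N(p_1,q)=2d_N(p_2,q)$ implies $q=\frac{p_1+p_2}{2}$, where addition and scalar multiplication are those of the vector space $\mathbb{R}^{2n+1}$. $N$ has the geodesic linearity property if for every map $\gamma:\mathbb{R}\to\mathbb{H}^n$ with $d_N(\gamma(s_1),\gamma(s_2))=|s_1-s_2|$ for all $s_1,s_2\in\mathbb{R}$ there exists $z_0\in\mathbb{R}^{2n}\setminus\{0\}$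 such that $\gamma(s)=\gamma(0)\ast(sz_0,0)$ for all $s\in\mathbb{R}$. *)

(* Defs.v *)
From HB Require Import structures.
From mathcomp Require Import all_boot all_order all_algebra.
From mathcomp Require Import reals.

Set Implicit Arguments.
Unset Strict Implicit.
Unset Printing Implicit Defensive.

Import Order.TTheory GRing.Theory Num.Theory.

Local Open Scope ring_scope.

(* The second factor is [R^o] so that the product is canonically an
   [lmodType R]: [+] and [*:] on [heis R n] are the vector space operations of
   R^(2n+1), not the group operations. *)
Definition heis (R : realType) (n : nat) : lmodType R :=
  ('cV[R]_(n + n) * R^o)%type.

Section Heisenberg.
Variables (R : realType) (n : nat).
Implicit Types (z : 'cV[R]_(n + n)) (p q : heis R n) (N : heis R n -> R).

Definition dotp z z' : R := \sum_i z i 0 * z' i 0.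

Definition J_mx : 'M[R]_(n + n) := block_mx 0 (- 1%:M) 1%:M 0.

Definition omega z z' : R := dotp z (J_mx *m z').

Definition hmul p q : heis R n :=
  (p.1 + q.1, p.2 + q.2 + 2 * omega p.1 q.1).

Definition hone : heis R n := (0, 0).

Definition hinv p : heis R n := (- p.1, - p.2).

Definition hdil (l : R) p : heis R n := (l *: p.1, l ^+ 2 * p.2).

Record homogeneous_norm N : Prop := HomogeneousNorm {
  hnorm_ge0 : forall p, 0 <= N p;
  hnorm_eq0 : forall p, N p = 0 <-> p = hone;
  hnorm_inv : forall p, N (hinv p) = N p;
  hnorm_mul : forall p q, N (hmul p q) <= N p + N q;
  hnorm_dil : forall p (l : R), 0 < l -> N (hdil l p) = l * N p }.

Definition hdist N p q : R := N (hmul (hinv p) q).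

Definition midpoint_property N : Prop :=
  forall p1 p2 q,
    hdist N p1 p2 = 2 * hdist N p1 q ->
    2 * hdist N p1 q = 2 * hdist N p2 q ->
    q = 2^-1 *: (p1 + p2).

Definition geodesic_linearity_property N : Prop :=
  forall gamma : R -> heis R n,
    (forall s1 s2, hdist N (gamma s1) (gamma s2) = `|s1 - s2|) ->
    exists2 z0 : 'cV[R]_(n + n), z0 != 0 &
      forall s, gamma s = hmul (gamma 0) (s *: z0, 0).

End Heisenberg.

(* Main.v *)
Require Import Defs.
From HB Require Import structures.
From mathcomp Require Import all_boot all_order all_algebra.
From mathcomp Require Import reals.
From mathcomp Require Import ring lra.

(** Write [gamma s = gamma 0 * c s].  Since left translations are isometries,
    [c] is again an isometric line, with [c 0 = e], and the midpoint property
    says that [c] maps midpoints to midpoints: [c] is additive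
    ([isometric_line_additive]).  It remains to see that [c] is horizontal and
    homogeneous.

    The main tool is [vertical_rigidity]: for given [z], the norms of [(z, m)]
    and [(z, 3m)] can agree only if [m = 0], since otherwise the segment from
    [e] to [(2z, 4m)] would have the metric midpoint [(z, m)] besides its
    linear midpoint [(z, 2m)].  It is used twice.
    - If [c s = (z, t)], then [c (s / 3)], dilated by 3, is [(z, 3t)]; it has
      norm [|s|] just as [(z, t)] has.  Hence [t = 0]
      ([additive_line_horizontal]).
    - So [c s = (f s, 0)] with [f] additive, and the distance from [c s] to
      [c (s + w)] is the norm of [(f w, - 2 omega (f s) (f w))].  It is [|w|]
      whatever [s] is; comparing [s] with [3s] shows that
      [omega (f s) (f w) = 0] ([horizontal_line_isotropic]).

    On the isotropic image of [f] the group law is vector addition, so there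
    [N] is subadditive.  The deviation from linearity, [f s - s f(1)], is
    additive in [s], vanishes at 1 and has norm at most [2 |s|]; by the
    Archimedean property it is zero ([additive_bounded_eq0]). *)

Set Implicit Arguments.
Unset Strict Implicit.
Unset Printing Implicit Defensive.

Import Order.TTheory GRing.Theory Num.Theory.

Local Open Scope ring_scope.

(** * The symplectic form and the group law *)

Lemma omegaE (R : realType) (n : nat) (z w : 'cV[R]_(n + n)) :
  omega z w = (z^T *m J_mx R n *m w) 0 0.
Proof.
by rewrite /omega /dotp -mulmxA mxE; apply: eq_bigr => i _; rewrite [z^T _ _]mxE.
Qed.

Lemma omegaDl (R : realType) (n : nat) (x y z : 'cV[R]_(n + n)) :
  omega (x + y) z = omega x z + omega y z.
Proof. by rewrite !omegaE linearD !mulmxDl mxE. Qed.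

Lemma omegaZl (R : realType) (n : nat) (a : R) (x z : 'cV[R]_(n + n)) :
  omega (a *: x) z = a * omega x z.
Proof. by rewrite !omegaE linearZ -!scalemxAl mxE. Qed.

Lemma omegaC (R : realType) (n : nat) (x y : 'cV[R]_(n + n)) :
  omega x y = - omega y x.
Proof.
have trJ : (J_mx R n)^T = - J_mx R n.
  by rewrite /J_mx tr_block_mx !linear0 linearN /= trmx1 opp_block_mx !oppr0 opprK.
rewrite !omegaE -[in LHS](trmxK (x^T *m _ *m y)) mxE.
by rewrite !trmx_mul trmxK trJ mulNmx mulmxN mulmxA mxE.
Qed.

Lemma omegaNl (R : realType) (n : nat) (x z : 'cV[R]_(n + n)) :
  omega (- x) z = - omega x z.
Proof. by rewrite -scaleN1r omegaZl mulN1r. Qed.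

Lemma omegaDr (R : realType) (n : nat) (x y z : 'cV[R]_(n + n)) :
  omega z (x + y) = omega z x + omega z y.
Proof. by rewrite omegaC omegaDl opprD -!omegaC. Qed.

Lemma omegaZr (R : realType) (n : nat) (a : R) (x z : 'cV[R]_(n + n)) :
  omega z (a *: x) = a * omega z x.
Proof. by rewrite omegaC omegaZl -mulrN -omegaC. Qed.

Lemma omegaNr (R : realType) (n : nat) (x z : 'cV[R]_(n + n)) :
  omega z (- x) = - omega z x.
Proof. by rewrite -scaleN1r omegaZr mulN1r. Qed.

Lemma omegazz (R : realType) (n : nat) (z : 'cV[R]_(n + n)) : omega z z = 0.
Proof. by have := omegaC z z; lra. Qed.

Lemma omega0l (R : realType) (n : nat) (z : 'cV[R]_(n + n)) : omega 0 z = 0.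
Proof. by rewrite -(scale0r 0) omegaZl mul0r. Qed.

Lemma hmulKV (R : realType) (n : nat) (g p : heis R n) :
  hmul g (hmul (hinv g) p) = p.
Proof.
case: g p => [g a] [p b]; congr pair => /=; first by rewrite addrA subrr add0r.
by rewrite omegaDr omegaNl omegaNr omegazz; ring.
Qed.

Lemma hmulVg (R : realType) (n : nat) (g : heis R n) :
  hmul (hinv g) g = hone R n.
Proof.
case: g => [g a]; congr pair => /=; first by rewrite addrC subrr.
by rewrite omegaNl omegazz; ring.
Qed.

Lemma hmul_hinv_hone (R : realType) (n : nat) (p : heis R n) :
  hmul (hinv (hone R n)) p = p.
Proof.
by case: p => [p b]; congr pair => /=; rewrite ?oppr0 ?add0r // omega0l; ring.
Qed.

Lemma hdist_hmull (R : realType) (n : nat) (N : heis R n -> R) (g p q : heis R n) :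
  hdist N (hmul g p) (hmul g q) = hdist N p q.
Proof.
case: g p q => [g a] [p b] [q c]; rewrite /hdist; congr (N _).
congr pair => /=; first by rewrite opprD addrACA addNr add0r.
by rewrite !(omegaNl, omegaDl, omegaDr) omegazz (omegaC p g); ring.
Qed.

(** * Consequences of the midpoint property *)

(** The linear midpoint of [e] and [(2z, 4m)] is [(z, 2m)], while [(z, m)] lies
    at distance [N (z, m)] from [e] and [N (z, 3m)] from the other end.  If these agree, both points
    are metric midpoints, so they coincide. *)
Lemma vertical_rigidity (R : realType) (n : nat) (N : heis R n -> R)
    (hN : homogeneous_norm N) (hmid : midpoint_property N)
    (z : 'cV[R]_(n + n)) (m : R) :
  N (z, 3 * m) = N (z, m) -> m = 0.
Proof.
move=> E.
have Dz : hmul (hinv (hone R n)) (z, m) = (z, m) by exact: hmul_hinv_hone.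
have D2 : hmul (hinv (hone R n)) (hdil 2 (z, m)) = hdil 2 (z, m).
  exact: hmul_hinv_hone.
have D3 : hmul (hinv (hdil 2 (z, m))) (z, m) = hinv (z, 3 * m) :> heis R n.
  congr pair => /=.
    by rewrite scaler_nat mulr2n opprD -addrA addNr addr0.
  by rewrite omegaNl omegaZl omegazz; ring.
have := hmid (hone R n) (hdil 2 (z, m)) (z, m).
rewrite /hdist Dz D2 D3 (hnorm_inv hN) E (hnorm_dil hN) //.
move=> /(_ erefl erefl) /(congr1 snd) /=.
by rewrite add0r /GRing.scale /=; lra.
Qed.

Lemma isometric_line_midpoint (R : realType) (n : nat) (N : heis R n -> R)
    (hmid : midpoint_property N) (c : R -> heis R n)
    (hc : forall s1 s2, hdist N (c s1) (c s2) = `|s1 - s2|) (s t : R) :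
  c ((s + t) / 2) = 2^-1 *: (c s + c t).
Proof.
have Es : 2 * `|s - (s + t) / 2| = `|s - t|.
  rewrite -[X in X * _](@ger0_norm _ 2) // -normrM; congr `|_|.
  by field.
have Et : 2 * `|t - (s + t) / 2| = `|s - t|.
  rewrite -[X in X * _](@ger0_norm _ 2) // -normrM distrC; congr `|_|.
  by field.
by apply: hmid; rewrite !hc ?Es ?Et.
Qed.

(** Jensen's equation with [c 0 = 0] is Cauchy's equation. *)
Lemma isometric_line_additive (R : realType) (n : nat) (N : heis R n -> R)
    (hmid : midpoint_property N) (c : R -> heis R n)
    (hc : forall s1 s2, hdist N (c s1) (c s2) = `|s1 - s2|)
    (c0 : c 0 = hone R n) (s t : R) :
  c (s + t) = c s + c t.
Proof.
have half x : c (x / 2) = 2^-1 *: c x.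
  have := isometric_line_midpoint hmid hc x 0.
  by rewrite addr0 c0 (_ : hone R n = 0) // addr0.
have := isometric_line_midpoint hmid hc s t; rewrite half.
by apply: scalerI; rewrite invr_eq0 pnatr_eq0.
Qed.

Lemma isometric_line_norm (R : realType) (n : nat) (N : heis R n -> R)
    (c : R -> heis R n)
    (hc : forall s1 s2, hdist N (c s1) (c s2) = `|s1 - s2|)
    (c0 : c 0 = hone R n) (s : R) :
  N (c s) = `|s|.
Proof. by rewrite -(hmul_hinv_hone (c s)) -c0 -normrN -[- s]add0r -hc. Qed.

(** * Horizontality of isometric lines *)

(** Linear scaling and dilation act differently on the vertical coordinate:
    dilating [c (s / 3)] by 3 restores the horizontal part of [c s] but
    triples its height. *)
Lemma additive_line_horizontal (R : realType) (n : nat) (N : heis R n -> R)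
    (hN : homogeneous_norm N) (hmid : midpoint_property N) (c : R -> heis R n)
    (cD : forall s t, c (s + t) = c s + c t) (cN : forall s, N (c s) = `|s|)
    (s : R) :
  (c s).2 = 0.
Proof.
apply: (vertical_rigidity hN hmid (z := (c s).1)).
have Ec : c s = c (s / 3) + c (s / 3) + c (s / 3).
  by rewrite -!cD; congr c; field.
have -> : ((c s).1, 3 * (c s).2) = hdil 3 (c (s / 3)) :> heis R n.
  rewrite Ec; case: (c _) => u a; congr pair => /=; last by ring.
  by rewrite scaler_nat mulrS mulr2n addrA.
rewrite (hnorm_dil hN) // cN -[X in X * _](@ger0_norm _ 3) // -normrM.
rewrite -[((c s).1, _)]surjective_pairing cN; congr `|_|.
by field.
Qed.

(** * Linearity of horizontal isometric lines *)

(** The distance from [(f s, 0)] to [(f (s + w), 0)] is [|w|] for every [s],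
    although the vertical part [- 2 omega (f s) (f w)] of the displacement is
    linear in [f s]. *)
Lemma horizontal_line_isotropic (R : realType) (n : nat) (N : heis R n -> R)
    (hN : homogeneous_norm N) (hmid : midpoint_property N)
    (f : {additive R -> 'cV[R]_(n + n)})
    (hf : forall s1 s2, hdist N (f s1, 0) (f s2, 0) = `|s1 - s2|) (s w : R) :
  omega (f s) (f w) = 0.
Proof.
have step x : N (f w, - 2 * omega (f x) (f w)) = `|w|.
  have <- : hdist N (f x, 0) (f (x + w), 0) = `|w|.
    by rewrite hf opprD addrA subrr add0r normrN.
  rewrite /hdist; congr (N _); congr pair => /=; rewrite raddfD.
    by rewrite addrA addNr add0r.
  by rewrite omegaDr !omegaNl omegazz; ring.
suff : - 2 * omega (f s) (f w) = 0 by lra.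
apply: (vertical_rigidity hN hmid (z := f w)).
rewrite (step s) -(step (s *+ 3)); congr (N (_, _)).
by rewrite [f (_ *+ _)]raddfMn -scaler_nat omegaZl; ring.
Qed.

(** Since [f] vanishes on the integers, [f (k s)] equals [f] at the fractional
    part of [k s], so [k * g (f s)] is bounded by [C] for all [k]. *)
Lemma additive_bounded_eq0 (R : realType) (V : zmodType)
    (f : {additive R -> V}) (g : V -> R) (C : R)
    (gMn : forall v k, g (v *+ k) = g v *+ k) (f1 : f 1 = 0)
    (gf : forall s, g (f s) <= C * `|s|) (s : R) :
  g (f s) <= 0.
Proof.
have C0 : 0 <= C by have := gf 1; rewrite f1 -(mulr0n 0) gMn mulr0n normr1 mulr1.
have bnd k : g (f s) *+ k <= C.
  rewrite -gMn -raddfMn -[s *+ k](subrK (Num.floor (s *+ k))%:~R).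
  rewrite raddfD [f _%:~R]raddfMz f1 mul0rz addr0.
  apply: le_trans (gf _) _; rewrite ler_piMr // ler_norml.
  have := floor_itv (s *+ k); rewrite intrD => /andP[]; set y := _%:~R.
  by move=> *; apply/andP; split; lra.
rewrite leNgt; apply/negP => g0.
have := Num.Theory.archi_boundP (divr_ge0 C0 (ltW g0)).
rewrite ltr_pdivrMr // => /lt_le_trans /(_ _) /negP.
by rewrite mulr_natl; move=> /(_ _ (bnd _)); rewrite ltxx.
Qed.

Lemma hnorm_horizontalMn (R : realType) (n : nat) (N : heis R n -> R)
    (hN : homogeneous_norm N) (z : 'cV[R]_(n + n)) (k : nat) :
  N (z *+ k, 0) = N (z, 0) *+ k.
Proof.
case: k => [|k]; first by rewrite !mulr0n; apply/(hnorm_eq0 hN).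
rewrite -[RHS]mulr_natl -(hnorm_dil hN) ?ltr0n //.
by rewrite /hdil /= mulr0 scaler_nat.
Qed.

Lemma hnorm_horizontalZ (R : realType) (n : nat) (N : heis R n -> R)
    (hN : homogeneous_norm N) (z : 'cV[R]_(n + n)) (a : R) :
  N (a *: z, 0) = `|a| * N (z, 0).
Proof.
have pos b : 0 < b -> N (b *: z, 0) = b * N (z, 0).
  by move=> b0; rewrite -(hnorm_dil hN) // /hdil /= mulr0.
have [a0|a0|->] := ltgtP a 0.
- rewrite -(hnorm_inv hN) /hinv /= oppr0 -scaleNr pos ?oppr_gt0 //.
  by rewrite ltr0_norm.
- by rewrite pos // gtr0_norm.
- by rewrite scale0r normr0 mul0r; apply/(hnorm_eq0 hN).
Qed.

(** The image of [f] is isotropic, hence so is its span: there the group law is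
    vector addition and [N] is a genuine vector space norm. *)
Lemma horizontal_line_linear (R : realType) (n : nat) (N : heis R n -> R)
    (hN : homogeneous_norm N) (hmid : midpoint_property N)
    (f : {additive R -> 'cV[R]_(n + n)})
    (hf : forall s1 s2, hdist N (f s1, 0) (f s2, 0) = `|s1 - s2|) (s : R) :
  f s = s *: f 1.
Proof.
have fN x : N (f x, 0) = `|x|.
  apply: (isometric_line_norm (c := fun x => (f x, 0) : heis R n)) => //.
  by rewrite raddf0.
pose d x := f x - x *: f 1.
have dA : {morph d : x y / x - y}.
  move=> x y; rewrite /d raddfB scalerBl !opprB addrACA [RHS]addrACA.
  by congr (_ + _); rewrite addrC.
pose dA' := GRing.isZmodMorphism.Build _ _ d dA.
pose D : {additive R -> 'cV[R]_(n + n)} := HB.pack d dA'.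
have : N (D s, 0) <= 0.
  apply: (additive_bounded_eq0 (g := fun v => N (v, 0)) (C := 2)).
  - exact: hnorm_horizontalMn.
  - by rewrite /= /d scale1r subrr.
  - move=> x.
    have -> : (D x, 0) = hmul (f x, 0) (- x *: f 1, 0) :> heis R n.
      congr pair => /=; first by rewrite /d scaleNr.
      by rewrite omegaZr (horizontal_line_isotropic hN hmid hf); ring.
    apply: le_trans (hnorm_mul hN _ _) _.
    by rewrite hnorm_horizontalZ // !fN normrN normr1; lra.
move=> Ds; have /(hnorm_eq0 hN)/(congr1 fst)/= : N (D s, 0) = 0.
  by apply/le_anti; rewrite Ds (hnorm_ge0 hN).
exact: subr0_eq.
Qed.

Theorem proposition3p15 (R : realType) (n : nat) (hn : (1 <= n)%N)
  (N : heis R n -> R) (hN : homogeneous_norm N) (hmid : midpoint_property N) :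
  geodesic_linearity_property N.
Proof.
move=> gamma hg.
pose c s := hmul (hinv (gamma 0)) (gamma s).
have hc s1 s2 : hdist N (c s1) (c s2) = `|s1 - s2| by rewrite hdist_hmull.
have c0 : c 0 = hone R n by exact: hmulVg.
have cD := isometric_line_additive hmid hc c0.
have cN := isometric_line_norm hc c0.
have ch := additive_line_horizontal hN hmid cD cN.
have cE s : c s = ((c s).1, 0) by rewrite -(ch s) -surjective_pairing.
pose f s := (c s).1.
have fB : {morph f : x y / x - y}.
  by move=> x y; apply/eqP; rewrite -subr_eq opprK /f -[_ + _]/((c _ + c _).1)
    -cD subrK.
pose fA := GRing.isZmodMorphism.Build _ _ f fB.
pose F : {additive R -> 'cV[R]_(n + n)} := HB.pack f fA.
have hF s1 s2 : hdist N (F s1, 0) (F s2, 0) = `|s1 - s2| by rewrite -!cE hc.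
exists (F 1).
  apply/eqP => F0; have := cN 1; rewrite cE -[(c 1).1]/(F 1) F0.
  move/eqP; rewrite normr1 (_ : N _ = 0) ?(eq_sym 0) ?oner_eq0 //.
  exact/(hnorm_eq0 hN).
move=> s; rewrite -(horizontal_line_linear hN hmid hF) -[F s]/((c s).1) -cE.
by rewrite hmulKV.
Qed.
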